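(* Let $\mathbb F$ be an algebraically closed field of characteristic zero. Let $A,A^*$ be a tridiagonal pair over $\mathbb F$ of Krawtchouk type with diameter $d$, and let $\hat P$ be its normalized Drinfel'd polynomial. Then $$\hat P(\lambda)=(-1)^d(d!)^2(\lambda+2)^d\,P_{A,A^*}\bigl(4(\lambda+2)^{-1}\bigr),$$ where $$P_{A,A^*}(\lambda)=\sum_{i=0}^d\frac{(-1)^i\zeta_i\lambda^i}{(i!)^2\,4^i}$$ and $\{\zeta_i\}_{i=0}^d$ is the split sequence of $A,A^*$ associated with the standard ordering $\{d-2i\}_{i=0}^d$ of the eigenvalues of $A$ and the standard ordering $\{2i-d\}_{i=0}^d$ of the eigenvalues of $A^*$.
   Context: Let $V$ be a vector space over $\mathbb F$ of finite positive dimension. A tridiagonal pair on $V$ is an ordered pair of $\mathbb F$-linear maps $A,A^*:V\to V$ ($A^*$ is just a name, not an adjoint) such that: (i) both are diagonalizable; (ii) the eigenspaces of $A$ can be ordered $V_0,\dots,V_d$ with $A^*V_i\subseteq V_{i-1}+V_i+V_{i+1}$ ($0\le i\le d$, $V_{-1}=V_{d+1}=0$); (iii) the eigenspaces of $A^*$ can be ordered $V^*_0,\dots,V^*_\delta$ with $AV^*_i\subseteq V^*_{i-1}+V^*_i+V^*_{i+1}$ ($0\le i\le\delta$, $V^*_{-1}=V^*_{\delta+1}=0$); (iv) no subspace $W\ne 0,V$ satisfies $AW\subseteq W$ and $A^*W\subseteq W$. It is known that $d=\delta$ (the diameter) and $\dim V_i=\dim V^*_i=\dim V_{d-i}$. Orderings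 as in (ii), (iii), and the corresponding orderings of eigenvalues, are called standard; the reversal of a standard ordering is standard, and there are no other standard orderings. Since $\mathbb F$ is algebraically closed, it is known that $\dim V_0=\dim V_0^*=1$ (the pair is sharp). The pair has Krawtchouk type if $\{d-2i\}_{i=0}^d$ is a standard ordering of the eigenvalues of $A$ and of the eigenvalues of $A^*$. Given standard orderings $\{\theta_i\}_{i=0}^d$, $\{\theta^*_i\}_{i=0}^d$ of the eigenvalues of $A$, $A^*$ (with corresponding eigenspaces $V_i,V^*_i$), the line $V^*_0$ is known to be invariant under $(A^*-\theta^*_1I)\cdots(A^*-\theta^*_iI)(A-\theta_{i-1}I)\cdots(A-\theta_0I)$ for $0\le i\le d$; $\zeta_i$ is the corresponding eigenvalue and $\{\zeta_i\}_{i=0}^d$ is the split sequence associated with these orderings ($\zeta_0=1$). Base $\beta$ of a tridiagonal pair: for $d\ge3$, $\beta+1$ is the common value of $\frac{\theta_{i-2}-\theta_{i+1}}{\theta_{i-1}-\theta_i}$ and $\frac{\theta^*_{i-2}-\theta^*_{i+1}}{\theta^*_{i-1}-\theta^*_i}$ for $2\le i\le d-1$; for $d\le 2$ the base is a chosen nonzero scalar. A pair of Krawtchouk type has $\beta=2$ when $d\geq 3$, and for $d\le2$ the base is taken to be $2$; thus the pair is of type II ($\beta=2$, characteristic $\ne2$). Normalized Drinfel'd polynomial (type II): choose standard orderings $\{\theta_i\}$, $\{\theta^*_i\}$ with split sequence $\{\zeta_i\}$; there are scalars $a,b,c,a^*,b^*,c^*\in\mathbb F$ (unique if $d\ge2$)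 with $\theta_i=a+b(i-d/2)+ci(d-i)$, $\theta^*_i=a^*+b^*(i-d/2)+c^*i(d-i)$ for $0\le i\le d$; put $\hat p_i=i^2\bigl(bb^*/2+(bc^*+cb^* )(d-i)+cc^*(d-i)^2-\lambda\bigr)$ for $1\le i\le d$ and $\hat P=\sum_{i=0}^d\zeta_i\,\hat p_{i+1}\hat p_{i+2}\cdots\hat p_d\in\mathbb F[\lambda]$. This polynomial does not depend on the choice of standard orderings, and is called the normalized Drinfel'd polynomial of $A,A^*$. *)

(* Defs.v *)
From HB Require Import structures.
From mathcomp Require Import all_boot all_order all_algebra.

Set Implicit Arguments.
Unset Strict Implicit.
Unset Printing Implicit Defensive.

Import GRing.Theory passmx.
Local Open Scope ring_scope.

Notation "x %:F" := (@FracField.tofrac _ x) : ring_scope.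

Section TridiagonalPairs.

Variables (F : fieldType) (V : vectType F).
Implicit Types (A As : 'End(V)) (th ths z : seq F) (d i : nat).

Definition lfun_diagonalizable A : Prop :=
  exists2 X : seq V, basis_of fullv X &
    forall x, x \in X -> exists a : F, A x = a *: x.

(* The sum over |i - j| <= 1 is V_(i-1) + V_i + V_(i+1), where               *)
(* V_(-1) = V_(size th) = 0.                                                  *)
Definition standard_ordering A As th : Prop :=
  [/\ uniq th,
      forall a, (a \in th) = leigenvalue A a &
      forall i, (i < size th)%N ->
        (As @: leigenspace A th`_i <=
           \sum_(j < size th | ((j <= i.+1) && (i <= j.+1))%N)
              leigenspace A th`_j)%VS].

Definition tridiagonal_pair A As : Prop :=
  [/\ lfun_diagonalizable A /\ lfun_diagonalizable As,
      exists th, standard_ordering A As th,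
      exists ths, standard_ordering As A ths &
      forall W : {vspace V}, (A @: W <= W)%VS -> (As @: W <= W)%VS ->
        W = 0%VS \/ W = fullv].

Definition has_diameter A As d : Prop :=
  (exists2 th, standard_ordering A As th & size th = d.+1) /\
  (exists2 ths, standard_ordering As A ths & size ths = d.+1).

(* d, d - 2, ..., -d *)
Definition krawtchouk_seq d : seq F :=
  mkseq (fun i => d%:R - (2 * i)%:R) d.+1.

(* -d, 2 - d, ..., d *)
Definition krawtchouk_seq_dual d : seq F :=
  mkseq (fun i => (2 * i)%:R - d%:R) d.+1.

Definition krawtchouk_type A As d : Prop :=
  standard_ordering A As (krawtchouk_seq d) /\
  standard_ordering As A (krawtchouk_seq d).

(* (As - ths_1) ... (As - ths_i) (A - th_(i-1)) ... (A - th_0); the factors   *)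
(* in each of the two products commute.                                       *)
Definition split_operator A As th ths i : 'End(V) :=
  ((\big[@comp_lfun F V V V / \1]_(1 <= j < i.+1) (As - ths`_j *: \1)) \o
   (\big[@comp_lfun F V V V / \1]_(0 <= j < i) (A - th`_j *: \1)))%VF.

Definition split_sequence A As th ths z : Prop :=
  size z = size th /\
  forall i, (i < size th)%N -> forall v, v \in leigenspace As ths`_0 ->
    split_operator A As th ths i v = z`_i *: v.

End TridiagonalPairs.

Section DrinfeldPolynomial.

Variables (F : fieldType).
Implicit Types (th z : seq F) (d i : nat).

Definition type_II_form d (a b c : F) th : Prop :=
  forall i, (i <= d)%N ->
    th`_i = a + b * (i%:R - d%:R / 2%:R) + c * (i * (d - i))%:R.

Definition p_hat d (b c bs cs : F) i : {poly F} :=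
  i%:R ^+ 2 *:
    ((b * bs / 2%:R + (b * cs + c * bs) * (d - i)%:R
        + c * cs * (d - i)%:R ^+ 2)%:P - 'X).

Definition P_hat d z (b c bs cs : F) : {poly F} :=
  \sum_(i < d.+1) z`_i *: \prod_(i.+1 <= j < d.+1) p_hat d b c bs cs j.

(* P is the polynomial obtained from some choice of standard orderings (and   *)
(* of the scalars a, b, c, a', b', c', which are not unique for d < 2).       *)
Definition normalized_Drinfeld_II (V : vectType F) (A As : 'End(V)) d
    (P : {poly F}) : Prop :=
  exists th ths z : seq F, exists a b c a' b' c' : F,
    [/\ standard_ordering A As th /\ size th = d.+1,
        standard_ordering As A ths /\ size ths = d.+1,
        split_sequence A As th ths z,
        type_II_form d a b c th /\ type_II_form d a' b' c' ths &
        P = P_hat d z b c b' c'].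

Definition krawtchouk_Drinfeld d z : {poly F} :=
  \sum_(i < d.+1) ((-1) ^+ i * z`_i / (i`!%:R ^+ 2 * 4%:R ^+ i)) *: 'X^i.

End DrinfeldPolynomial.

(* Main.v *)
Require Import Defs.
From HB Require Import structures.
From mathcomp Require Import all_boot all_order all_algebra.
From mathcomp Require Import ring zify.

Set Implicit Arguments.
Unset Strict Implicit.
Unset Printing Implicit Defensive.

Import GRing.Theory passmx.
Local Open Scope ring_scope.

(** For the orderings [d - 2i] of the eigenvalues of [A] and [2i - d] of those
    of [As], every factor [p_hat] is [- j ^ 2 * (lambda + 2)], and the asserted
    formula is a rewriting of the definition ([P_hat_krawtchouk]). The substance
    is that the polynomial does not depend on the standard orderings.

    A standard ordering is unique up to reversal ([standard_ordering_unique]):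
    irreducibility forces consecutive entries of one ordering to be neighbours
    in the other. So two reversals must be shown harmless.

    Reversal for [A]. Let [v] be a vector of the first eigenspace of [As] and
    project the vector [f(A) v] back to that eigenspace. Since the split
    sequence exists, the result is [mu(f) v] with [mu(f) = sum_y f(th_y) m_y]
    for some weight [m] on the eigenvalues of [A], and [zeta_i] is, up to an
    explicit factor, the value of [mu] at [(x - th_0) ... (x - th_(i-1))]
    ([split_weights]). The weight does not see how the eigenvalues of [A] are
    ordered. When the eigenvalues are in arithmetic progression with steps [b]
    and [b'], the binomial formula gives
    [P = d!^2 sum_y m_y (b b'/2 - lambda)^(d-y) (- b b'/2 - lambda)^y]
    ([P_hat_of_weights]), and reversal exchanges [b] with [- b] and [y] with
    [d - y] ([P_hat_reversal]).

    Reversal for [As]. This changes the eigenspace on which the split sequence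
    lives. But a split sequence of [(A, As)] is also one of [(As, A)] for the
    same orderings ([split_sequence_swap]), where it lives on the first
    eigenspace of [A]. To see this, let [P0] and [Q0] be the projections onto the
    first eigenspaces of [As] and of [A], and compare the scalars by which
    [P0 f(A) g(As) Q0], with [f] and [g] monic of degree [i], is a multiple of
    [P0 Q0]. The tridiagonal relations make the roots of [f] irrelevant
    when [g] vanishes at the first [i] eigenvalues of [As], and those of [g]
    irrelevant when [f] vanishes at the first [i] eigenvalues of [A]. Finally
    [P0 Q0] loses nothing, as [P0] is injective on the first eigenspace of [A] by
    irreducibility ([first_eigenspace_disjoint]). *)

(** * Products of linear factors, sums of eigenspaces, and flags *)

Section Operators.

Variables (F : fieldType) (V : vectType F).
Implicit Types (A As : 'End(V)) (s t th ths z : seq F) (U W : {vspace V}).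

(** Every polynomial in [A] that occurs is a product of linear factors, so a
    list of roots replaces a polynomial, and subsets and prefixes of lists
    replace divisibility and degrees. *)
Definition factors A s : 'End(V) :=
  \big[@comp_lfun F V V V / \1%VF]_(c <- s) (A - c *: \1%VF).

(** With [take i th] and [drop i th] for [s] these are the two opposite flags
    attached to an ordering [th] of the eigenvalues. *)
Definition eigsum A s : {vspace V} := (\sum_(c <- s) leigenspace A c)%VS.

Lemma leigenspaceP A c v : reflect (A v = c *: v) (v \in leigenspace A c).
Proof.
rewrite memv_ker add_lfunE opp_lfunE scale_lfunE id_lfunE subr_eq0.
exact: eqP.
Qed.

Lemma factors_nil A v : factors A [::] v = v.
Proof. by rewrite /factors big_nil id_lfunE. Qed.

Lemma factors_cons A c s v :
  factors A (c :: s) v = A (factors A s v) - c *: factors A s v.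
Proof.
by rewrite /factors big_cons comp_lfunE add_lfunE opp_lfunE scale_lfunE id_lfunE.
Qed.

Lemma factors_cat A s t v : factors A (s ++ t) v = factors A s (factors A t v).
Proof. by elim: s => [|c s IH] /=; rewrite ?factors_nil // !factors_cons IH. Qed.

Lemma factors_comm A s v : A (factors A s v) = factors A s (A v).
Proof.
elim: s => [|c s IH]; first by rewrite !factors_nil.
by rewrite !factors_cons -IH linearB linearZ.
Qed.

Lemma factors_rcons A c s v : factors A (rcons s c) v = factors A (c :: s) v.
Proof.
rewrite -cats1 factors_cat !factors_cons !factors_nil.
by rewrite linearB linearZ /= factors_comm.
Qed.

Lemma factors_eigen A s a v : v \in leigenspace A a ->
  factors A s v = (\prod_(c <- s) (a - c)) *: v.
Proof.
move=> /leigenspaceP Av; elim: s => [|c s IH].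
  by rewrite factors_nil big_nil scale1r.
rewrite factors_cons IH big_cons linearZ /= Av !scalerA -scalerBl.
by congr (_ *: _); ring.
Qed.

Lemma factors_eigen0 A s a v : v \in leigenspace A a -> a \in s -> factors A s v = 0.
Proof.
by move=> /factors_eigen -> a_s; rewrite (big_rem a a_s) /= subrr mul0r scale0r.
Qed.

Lemma prod_sub_neq0 (a : F) s : a \notin s -> \prod_(c <- s) (a - c) != 0.
Proof.
move=> a_s; rewrite prodf_seq_neq0; apply/allP => c c_s /=.
by rewrite subr_eq0; apply: contraNneq a_s => ->.
Qed.

Lemma eigsum_nil A : eigsum A [::] = 0%VS.
Proof. by rewrite /eigsum big_nil. Qed.

Lemma eigsum_cons A c s : eigsum A (c :: s) = (leigenspace A c + eigsum A s)%VS.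
Proof. by rewrite /eigsum big_cons. Qed.

Lemma eigsum_rcons A s c :
  eigsum A (rcons s c) = (eigsum A s + leigenspace A c)%VS.
Proof. by rewrite /eigsum big_rcons. Qed.

Lemma eigsum1 A c : eigsum A [:: c] = leigenspace A c.
Proof. by rewrite /eigsum big_seq1. Qed.

Lemma sub_eigsum A s c : c \in s -> (leigenspace A c <= eigsum A s)%VS.
Proof.
elim: s => // a s IH; rewrite inE eigsum_cons => /predU1P[->|/IH sub_s].
  exact: addvSl.
exact: subv_trans sub_s (addvSr _ _).
Qed.

Lemma eigsum_subP A s U :
  (forall c, c \in s -> (leigenspace A c <= U)%VS) -> (eigsum A s <= U)%VS.
Proof.
elim: s => [|c s IH] sub_s; first by rewrite eigsum_nil sub0v.
rewrite eigsum_cons subv_add sub_s ?mem_head //; apply: IH => a a_s.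
by apply: sub_s; rewrite inE a_s orbT.
Qed.

Lemma eigsumS A s t : {subset s <= t} -> (eigsum A s <= eigsum A t)%VS.
Proof. by move=> st; apply: eigsum_subP => c /st /sub_eigsum. Qed.

Lemma eigsum_stable A s v : v \in eigsum A s -> A v \in eigsum A s.
Proof.
suff /subvP sub_s : (eigsum A s <= A @^-1: eigsum A s)%VS.
  by move/sub_s; rewrite -memv_preim.
apply: eigsum_subP => c c_s; apply/subvP => x xc; rewrite -memv_preim.
move/leigenspaceP: (xc) => ->; apply: rpredZ.
exact: subvP (sub_eigsum A c_s) _ xc.
Qed.

Lemma factors_stable A t U v :
  (forall x, x \in U -> A x \in U) -> v \in U -> factors A t v \in U.
Proof.
move=> stU Uv; elim: t => [|c t IH]; first by rewrite factors_nil.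
by rewrite factors_cons rpredB ?rpredZ ?stU.
Qed.

(** The factors with root in [t] kill those eigenspaces, the others being
    preserved. *)
Lemma eigsum_factors A t s r v : {subset s <= t ++ r} ->
  v \in eigsum A s -> factors A t v \in eigsum A r.
Proof.
move=> st; suff /subvP sub_s : (eigsum A s <= factors A t @^-1: eigsum A r)%VS.
  by move/sub_s; rewrite -memv_preim.
apply: eigsum_subP => c /st; rewrite mem_cat => c_tr.
apply/subvP => x xc; rewrite -memv_preim.
have [c_t|c_t] := boolP (c \in t); first by rewrite (factors_eigen0 xc) ?mem0v.
rewrite (negPf c_t) /= in c_tr.
by rewrite (factors_eigen t xc) rpredZ // (subvP (sub_eigsum A c_tr)).
Qed.

Lemma eigsum_factors0 A t s v : {subset s <= t} ->
  v \in eigsum A s -> factors A t v = 0.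
Proof.
move=> st /(@eigsum_factors A t s [::] v); rewrite cats0 => /(_ st).
by rewrite eigsum_nil memv0 => /eqP.
Qed.

Lemma eigsum_full A th : lfun_diagonalizable A ->
  (forall a, (a \in th) = leigenvalue A a) -> eigsum A th = fullv.
Proof.
case=> X bX eigX thP; apply/eqP; rewrite eqEsubv subvf /=.
rewrite -(span_basis bX); apply/span_subvP => x Xx.
have [a Ax] := eigX x Xx.
have x_a : x \in leigenspace A a by apply/leigenspaceP.
have x0 : x != 0 := free_not0 (basis_free bX) Xx.
have th_a : a \in th.
  rewrite thP /leigenvalue; apply: contra x0 => /eqP E0.
  by rewrite -memv0 -E0.
exact: subvP (sub_eigsum A th_a) _ x_a.
Qed.


(** The list [t] is any set of eigenvalues containing the neighbours of the
    index [i]; it is a prefix or a suffix of [th] when flags are moved, and the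
    exact neighbourhood when two orderings are compared. *)
Lemma standard_step A As th t i x : standard_ordering A As th ->
  (i < size th)%N ->
  (forall j, (j < size th)%N -> (j <= i.+1)%N -> (i <= j.+1)%N -> th`_j \in t) ->
  x \in leigenspace A th`_i -> As x \in eigsum A t.
Proof.
move=> [_ _ /(_ i) tri] lti tP xi; have := memv_img As xi.
apply/subvP/(subv_trans (tri lti)); apply/subv_sumP => j /andP[ji ij].
exact/sub_eigsum/tP.
Qed.

Lemma mem_takeP s i a :
  reflect (exists j, [/\ (j < i)%N, (j < size s)%N & a = s`_j]) (a \in take i s).
Proof.
apply: (iffP idP) => [/(nthP 0)[j]|[j [ji js ->]]].
  rewrite size_take_min ltn_min => /andP[ji js] <-.
  by exists j; rewrite nth_take.
by rewrite -(nth_take 0 ji) mem_nth // size_take_min ltn_min ji.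
Qed.

Lemma mem_dropP s i a :
  reflect (exists j, [/\ (i <= j)%N, (j < size s)%N & a = s`_j]) (a \in drop i s).
Proof.
apply: (iffP idP) => [/(nthP 0)[j]|[j [ij js ->]]].
  rewrite size_drop ltn_subRL => js <-.
  by exists (i + j)%N; rewrite leq_addr nth_drop.
rewrite -(subnKC ij) -nth_drop mem_nth // size_drop ltn_sub2r //.
exact: leq_ltn_trans ij js.
Qed.

Lemma step_take A As th i x : standard_ordering A As th ->
  x \in eigsum A (take i th) -> As x \in eigsum A (take i.+1 th).
Proof.
move=> std; suff /subvP sub_i : (eigsum A (take i th)
    <= As @^-1: eigsum A (take i.+1 th))%VS by move/sub_i; rewrite -memv_preim.
apply: eigsum_subP => _ /mem_takeP[j [ji js ->]]; apply/subvP => y yj.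
rewrite -memv_preim; apply: standard_step std js _ yj => k ks kj _.
by apply/mem_takeP; exists k; split=> //; rewrite ltnS (leq_trans kj).
Qed.

Lemma step_drop A As th i x : standard_ordering A As th ->
  x \in eigsum A (drop i.+1 th) -> As x \in eigsum A (drop i th).
Proof.
move=> std; suff /subvP sub_i : (eigsum A (drop i.+1 th)
    <= As @^-1: eigsum A (drop i th))%VS by move/sub_i; rewrite -memv_preim.
apply: eigsum_subP => _ /mem_dropP[j [ij js ->]]; apply/subvP => y yj.
rewrite -memv_preim; apply: standard_step std js _ yj => k ks _ jk.
by apply/mem_dropP; exists k; split=> //; rewrite -ltnS (leq_trans ij).
Qed.

Lemma eigsum_takeS A th i j x : (i <= j)%N ->
  x \in eigsum A (take i th) -> x \in eigsum A (take j th).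
Proof.
move=> ij; apply/subvP/eigsumS => _ /mem_takeP[k [ki ks ->]].
by apply/mem_takeP; exists k; rewrite (leq_trans ki).
Qed.

Lemma eigsum_dropS A th i j x : (j <= i)%N ->
  x \in eigsum A (drop i th) -> x \in eigsum A (drop j th).
Proof.
move=> ij; apply/subvP/eigsumS => _ /mem_dropP[k [ki ks ->]].
by apply/mem_dropP; exists k; rewrite (leq_trans ij).
Qed.

Lemma factors_take A As th s k x : standard_ordering A As th ->
  x \in eigsum A (take k th) -> factors As s x \in eigsum A (take (k + size s) th).
Proof.
move=> std xk; elim: s => [|c s IH]; first by rewrite factors_nil addn0.
rewrite factors_cons /= addnS rpredB ?(step_take std) //.
exact/rpredZ/eigsum_takeS/IH.
Qed.

Lemma factors_drop A As th s k x : standard_ordering A As th ->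
  x \in eigsum A (drop (k + size s) th) -> factors As s x \in eigsum A (drop k th).
Proof.
move=> std; elim: s k => [|c s IH] k; first by rewrite factors_nil addn0.
rewrite /= addnS -addSn factors_cons => /IH xk.
by rewrite rpredB ?(step_drop std) // rpredZ // (eigsum_dropS (leqnSn k)).
Qed.

(** Two monic polynomials of the same degree differ by lower degree terms, and
    a term of degree [n] in [As] climbs at most [n] steps of the flag of [A];
    so the choice of roots only matters modulo the next smaller step. *)
Lemma factors_take_eqmod A As th s t k x : standard_ordering A As th ->
    size s = size t -> x \in eigsum A (take k.+1 th) ->
  factors As s x - factors As t x \in eigsum A (take (k + size s) th).
Proof.
move=> std + xk; elim: s t => [|c s IH] [|b t] //=.
  by rewrite !factors_nil subrr mem0v.
move=> [st]; rewrite !factors_cons.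
have -> : As (factors As s x) - c *: factors As s x
      - (As (factors As t x) - b *: factors As t x)
    = As (factors As s x - factors As t x)
      - (c *: factors As s x - b *: factors As t x).
  by rewrite (linearB As) !opprD !opprK addrACA.
rewrite addnS -addSn rpredB //; first by rewrite (step_take std) // IH.
apply: rpredB; apply: rpredZ; first exact: factors_take std xk.
by rewrite st; apply: factors_take std xk.
Qed.

(** The same comparison on the descending flag. *)
Lemma factors_drop_eqmod A As th s t k x : standard_ordering A As th ->
    size s = size t -> x \in eigsum A (drop (k + size s) th) ->
  factors As s x - factors As t x \in eigsum A (drop k.+1 th).
Proof.
move=> std; elim: s t k => [|c s IH] [|b t] k //=.
  by rewrite !factors_nil subrr mem0v.
move=> [st]; rewrite addnS -addSn => xk; rewrite !factors_cons.
have -> : As (factors As s x) - c *: factors As s x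
      - (As (factors As t x) - b *: factors As t x)
    = As (factors As s x - factors As t x)
      - (c *: factors As s x - b *: factors As t x).
  by rewrite (linearB As) !opprD !opprK addrACA.
rewrite rpredB //; first by rewrite (step_drop std) // IH.
by rewrite rpredB // rpredZ // (factors_drop std) // -st.
Qed.

Lemma split_operatorE A As th ths i v : (i < size th)%N -> (i < size ths)%N ->
  split_operator A As th ths i v =
  factors As (take i (behead ths)) (factors A (take i th) v).
Proof.
move=> ith iths; rewrite /split_operator comp_lfunE.
have -> : take i (behead ths) = [seq ths`_j | j <- iota 1 i].
  by rewrite map_nth_iota ?drop1 // subn1 -ltnS (ltn_predK iths).
have -> : take i th = [seq th`_j | j <- iota 0 i].
  by rewrite map_nth_iota0 // ltnW.
by rewrite /factors !big_map /index_iota subSS !subn0.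
Qed.

End Operators.


(** * Exchanging the two maps *)

Section Swap.

Variables (F : fieldType) (V : vectType F).
Implicit Types (A As : 'End(V)) (s t th ths z : seq F) (U W : {vspace V}).

Definition irreducible_pair A As : Prop :=
  forall W : {vspace V}, (A @: W <= W)%VS -> (As @: W <= W)%VS ->
    W = 0%VS \/ W = fullv.

Lemma eigenvector_ex A th a : (forall c, (c \in th) = leigenvalue A c) ->
  a \in th -> exists2 v, v \in leigenspace A a & v != 0.
Proof.
move=> ->; rewrite /leigenvalue => E0.
by exists (vpick (leigenspace A a)); rewrite ?memv_pick ?vpick0.
Qed.

Lemma eigenvector_notin A s a v : a \notin s ->
  v \in leigenspace A a -> v \in eigsum A s -> v = 0.
Proof.
move=> a_s va /(@eigsum_factors0 _ _ _ s)-/(_ _)/= act0.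
have := act0 (fun x xs => xs); rewrite (factors_eigen s va) => /eqP.
by rewrite scaler_eq0 (negPf (prod_sub_neq0 a_s)) => /eqP.
Qed.

Lemma factors_behead_ker A (t0 : F) t y :
    t0 \notin t -> eigsum A (t0 :: t) = fullv ->
  factors A t y = 0 -> y \in eigsum A t.
Proof.
move=> t0_t full; have := memvf y.
rewrite -full eigsum_cons => /memv_addP[u u0 [w wt ->]].
rewrite linearD /= (eigsum_factors0 _ wt) // addr0 (factors_eigen t u0) => /eqP.
by rewrite scaler_eq0 (negPf (prod_sub_neq0 t0_t)) => /eqP->; rewrite add0r.
Qed.

Lemma img_sub_sum (n : nat) (T : nat -> {vspace V}) A W :
  (forall i x, (i < n)%N -> x \in T i -> A x \in W) ->
  (A @: (\sum_(i < n) T i) <= W)%VS.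
Proof.
move=> AT; rewrite limg_sum; apply/subv_sumP => i _.
by apply/subvP => _ /memv_imgP[x xi ->]; apply: AT xi.
Qed.

(** This is where irreducibility enters the exchange of [A] and [As]: the sum
    over [i] of the intersections of the [i]-th steps of the flag of [A] and of
    the opposite flag of [As] is stable under both maps, and is proper because
    it lies in the sum of all eigenspaces of [As] but the first. Hence it
    vanishes. *)
Lemma first_eigenspace_disjoint A As th ths v :
    irreducible_pair A As ->
    standard_ordering A As th -> standard_ordering As A ths ->
    size th = size ths ->
  v \in leigenspace A th`_0 -> v \in eigsum As (behead ths) -> v = 0.
Proof.
move=> irr std stds sz v0 vs.
case: th std sz v0 => [|t0 th] std; case: ths stds vs => [|s0 ths] // stds vs sz.
  by move=> _; move: vs; rewrite /= eigsum_nil memv0 => /eqP.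
set th' := t0 :: th in std sz *; set ths' := s0 :: ths in stds vs sz *.
move=> v0; pose n := size ths'.
pose T i := (eigsum A (take i th') :&: eigsum As (drop i ths'))%VS.
pose W := (\sum_(i < n.+1) T i)%VS.
have TW i x : (i <= n)%N -> x \in T i -> x \in W.
  rewrite -ltnS => lin; apply/subvP.
  by rewrite /W (sumv_sup (Ordinal lin)).
have T0 x : x \in T 0%N -> x = 0.
  by rewrite memv_cap take0 eigsum_nil memv0 => /andP[/eqP].
have Tn x : x \in T n -> x = 0.
  by rewrite memv_cap drop_size eigsum_nil memv0 => /andP[_ /eqP].
have AW : (A @: W <= W)%VS.
  apply: img_sub_sum => -[|i] x lin xT; first by rewrite (T0 _ xT) linear0 mem0v.
  rewrite -[A x](subrK (th'`_i *: x)) rpredD ?rpredZ //; last exact: TW xT.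
  apply: (TW i); first exact: ltnW.
  move: xT; rewrite !memv_cap => /andP[xA xs]; apply/andP; split.
    rewrite -(factors_nil A x) -factors_cons; apply: eigsum_factors xA.
    by rewrite (take_nth 0) ?sz // => c; rewrite mem_rcons.
  by rewrite rpredB ?(step_drop stds) // rpredZ // (eigsum_dropS (leqnSn i)).
have AsW : (As @: W <= W)%VS.
  apply: img_sub_sum => i x lin xT.
  have [ni|ni] := eqVneq i n.
    by rewrite ni in xT; rewrite (Tn _ xT) linear0 mem0v.
  have {}lin : (i < n)%N by rewrite ltn_neqAle ni -ltnS.
  rewrite -[As x](subrK (ths'`_i *: x)) rpredD ?rpredZ //; last first.
    exact: TW (ltnW lin) xT.
  apply: (TW i.+1) => //.
  move: xT; rewrite !memv_cap => /andP[xA xs]; apply/andP; split.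
    by rewrite rpredB ?(step_take std) // rpredZ // (eigsum_takeS (leqnSn i)).
  rewrite -(factors_nil As x) -factors_cons; apply: eigsum_factors xs.
  by rewrite (drop_nth 0).
have [W0|Wfull] := irr W AW AsW.
  apply/eqP; rewrite -memv0 -W0; apply: (TW 1%N) => //.
  by rewrite memv_cap /= take0 drop0 eigsum1 v0.
have s0s : s0 \notin ths by case: stds => /= /andP[].
have [u us u0] : exists2 u, u \in leigenspace As s0 & u != 0.
  by apply: (@eigenvector_ex _ ths'); [case: stds | exact: mem_head].
suff us' : u \in eigsum As ths by rewrite (eigenvector_notin s0s us us') eqxx in u0.
suff /subvP WS : (W <= eigsum As ths)%VS by apply: WS; rewrite Wfull memvf.
apply/subv_sumP => -[[|i] lin] _; apply/subvP => x.
  by move/T0=> ->; rewrite mem0v.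
rewrite memv_cap => /andP[_].
by move/(eigsum_dropS (ltn0Sn i)); rewrite drop1.
Qed.


Lemma factorsC A s t v : factors A s (factors A t v) = factors A t (factors A s v).
Proof.
elim: s => [|c s IH]; first by rewrite !factors_nil.
rewrite !factors_cons IH (linearB (factors A t)) (linearZ_LR (factors A t)).
by rewrite (factors_comm A t).
Qed.

(** Up to a nonzero scalar [factors As (behead ths)] is the projection onto the
    first eigenspace of [As], along the others; using it avoids dividing. *)
Lemma factors_behead_eigen As ths s x : eigsum As ths = fullv ->
  factors As (behead ths) (factors As s x)
    = (\prod_(c <- s) (ths`_0 - c)) *: factors As (behead ths) x.
Proof.
move=> full; rewrite factorsC; apply: factors_eigen.
rewrite -eigsum1; apply: (@eigsum_factors _ _ _ _ ths); last by rewrite full memvf.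
by case: ths {full} => [|t0 t] c //=; rewrite mem_cat !inE orbC.
Qed.

(** The definition of [z] applies a product to a vector of the first eigenspace
    of [As]; this is the transposed relation, in which the projection onto that
    eigenspace stands on the left and the argument is arbitrary. It holds on
    each eigenspace of [As]: the [j]-th one is killed by the inner product when
    [1 <= j <= i], and does not reach the first one in [i] steps when
    [j > i]. *)
Lemma split_row A As th ths z i x :
    standard_ordering As A ths -> eigsum As ths = fullv ->
    size th = size ths -> split_sequence A As th ths z -> (i < size th)%N ->
  factors As (behead ths)
      (factors A (take i th) (factors As (take i (behead ths)) x))
    = z`_i *: factors As (behead ths) x.
Proof.
move=> stds full sz [_ /(_ i)] + lti => /(_ lti) zi.
set N := factors As (behead ths); set T := factors A (take i th).
set P := factors As (take i (behead ths)).
suff : (eigsum As ths <= lker ((N \o T \o P) - z`_i *: N)%VF)%VS.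
  rewrite full => /subvP/(_ x (memvf x)); rewrite memv_ker.
  by rewrite !(add_lfunE, opp_lfunE, comp_lfunE, scale_lfunE) subr_eq0 => /eqP.
apply: eigsum_subP => _ /(nthP 0)[j js <-]; apply/subvP => y yj.
rewrite memv_ker !(add_lfunE, opp_lfunE, comp_lfunE, scale_lfunE) subr_eq0.
apply/eqP; have [j0|j_gt0] := posnP j.
  subst j; rewrite /P (factors_eigen _ yj) !linearZ /=.
  rewrite -(factors_behead_eigen _ _ full).
  have := zi y yj; rewrite split_operatorE -?sz // -/T -/P => ->.
  by rewrite linearZ.
have jb : ths`_j = (behead ths)`_j.-1 by rewrite nth_behead prednK.
have jsb : (j.-1 < size (behead ths))%N.
  by rewrite size_behead -ltnS !prednK // (leq_ltn_trans _ js).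
have Ny : N y = 0 by apply: factors_eigen0 yj _; rewrite jb mem_nth.
rewrite Ny scaler0; have [ji|ij] := leqP j i.
  rewrite /P (factors_eigen0 yj) ?linear0 //.
  by apply/mem_takeP; exists j.-1; split=> //; rewrite prednK.
rewrite /P (factors_eigen _ yj) !linearZ /=.
rewrite [N _](@eigsum_factors0 _ _ _ _ (drop 1 ths)) ?scaler0 ?drop1 // -drop1.
apply: (factors_drop (k := 1) stds).
rewrite size_take lti; apply: subvP yj; apply: sub_eigsum.
by apply/mem_dropP; exists j.
Qed.

(** For [u] in the first eigenspace of [A], the split operator for [(As, A)]
    differs from the one of [split_row] only in which [i] of the roots
    are used; by degree considerations this is invisible after projecting to the
    first eigenspace of [As], and that projection is injective on the first
    eigenspace of [A]. *)
Lemma split_sequence_swap A As th ths z :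
    irreducible_pair A As ->
    standard_ordering A As th -> standard_ordering As A ths ->
    eigsum A th = fullv -> eigsum As ths = fullv -> size th = size ths ->
  split_sequence A As th ths z -> split_sequence As A ths th z.
Proof.
move=> irr std stds full fulls sz zP; split; first by case: zP => ->.
move=> i; rewrite -sz => lti u u0; have lti' : (i < size ths)%N by rewrite -sz.
have th_gt0 : (0 < size th)%N by apply: leq_ltn_trans lti.
have thE : th = th`_0 :: behead th by case: (th) th_gt0.
have thsE : ths = ths`_0 :: behead ths by case: (ths) lti'.
have szt : size (take i th) = i by rewrite size_take lti.
have szts : size (take i ths) = i by rewrite size_take lti'.
have sztb : size (take i (behead th)) = i.
  by rewrite size_takel // size_behead -ltnS prednK.
have sztbs : size (take i (behead ths)) = i.
  by rewrite size_takel // size_behead -ltnS -sz prednK.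
have u1 : u \in eigsum A (take 1 th) by rewrite thE /= take0 eigsum1.
rewrite split_operatorE //.
apply/eqP; rewrite -subr_eq0; apply/eqP; set y := _ - _.
apply: (first_eigenspace_disjoint irr std stds sz).
  rewrite /y rpredB ?rpredZ // -eigsum1.
  apply: (@eigsum_factors _ _ _ _ (take i.+1 th)).
    rewrite {1}thE /= => c; rewrite inE mem_cat mem_seq1 orbC.
    by case/orP=> ->; rewrite ?orbT.
  by have /= := factors_take (take i ths) std u1; rewrite szts add1n.
apply: (factors_behead_ker (t0 := ths`_0)); rewrite -?thsE //.
  by case: stds; rewrite {1}thsE /= => /andP[].
set N := factors As (behead ths); set w := factors As (take i ths) u.
have wi : w \in eigsum As (drop i ths).
  apply: (@eigsum_factors _ _ _ _ ths); last by rewrite fulls memvf.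
  by move=> c; rewrite cat_take_drop.
rewrite /y; have -> : factors A (take i (behead th)) w = factors A (take i th) w
      + (factors A (take i (behead th)) w - factors A (take i th) w).
  by rewrite addrC subrK.
have N0 v : v \in eigsum As (drop 1 ths) -> N v = 0.
  by apply: eigsum_factors0 => c; rewrite drop1.
(* replace the roots of the factor in [A], modulo the kernel of [N] *)
rewrite linearB linearD /= (N0 (_ - _)) ?addr0; last first.
  by apply: (factors_drop_eqmod stds); rewrite ?sztb ?szt // add0n.
(* replace the roots of the factor in [As], modulo what [take i th] kills *)
have -> : w = factors As (take i (behead ths)) u
      + (w - factors As (take i (behead ths)) u) by rewrite addrC subrK.
rewrite (linearD (factors A (take i th))) (linearD N) /=.
rewrite (@eigsum_factors0 _ _ _ _ (take i th) (_ - _)) //; last first.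
  have := @factors_take_eqmod _ _ A As th (take i ths) (take i (behead ths)) 0 u std.
  by rewrite szts sztbs add0n; apply.
by rewrite linear0 addr0 (split_row _ stds fulls sz zP) // (linearZ_LR N) subrr.
Qed.

End Swap.


(** * Split sequences as moments of a weight on the eigenvalues *)

Section Weights.

Variables (F : fieldType) (V : vectType F).
Implicit Types (A As : 'End(V)) (s t th ths z : seq F).

(** Spectral decomposition of [v], read through one coordinate of [N]. *)
Lemma spectral_weights A th (N : 'End(V)) j v :
    uniq th -> v \in eigsum A th ->
  exists m : F -> F, forall s,
    coord (vbasis fullv) j (N (factors A s v))
      = \sum_(a <- th) (\prod_(c <- s) (a - c)) * m a.
Proof.
elim: th v => [|a th IH] v.
  move=> _; rewrite eigsum_nil memv0 => /eqP->.
  by exists (fun=> 0) => s; rewrite !linear0 big_nil.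
rewrite eigsum_cons => /= /andP[a_th /IH{}IH].
case/memv_addP=> u ua [w /IH[m mP] ->].
exists (fun x => if x == a then coord (vbasis fullv) j (N u) else m x) => s.
rewrite big_cons eqxx linearD linearD linearD /=; congr (_ + _); last rewrite mP.
  by rewrite (factors_eigen s ua) !linearZ.
rewrite !big_seq; apply: eq_bigr => x x_th.
by case: eqP x_th => // ->; rewrite (negPf a_th).
Qed.

(** After projecting to the first eigenspace of [As], the [i]-th split operator
    becomes evaluation of a product of [i] linear factors at [A]. So [z] lists
    the moments of a weight [m] on the eigenvalues, and the point is that [m]
    depends on [A] and [ths] but not on the ordering [th'] of the eigenvalues
    of [A]. *)
Lemma split_weights A As th ths :
    uniq th -> eigsum A th = fullv ->
    standard_ordering As A ths -> eigsum As ths = fullv -> (0 < size ths)%N ->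
  exists m : F -> F, forall th' z i,
    split_sequence A As th' ths z -> size th' = size ths -> (i < size ths)%N ->
  z`_i = (\prod_(c <- take i (behead ths)) (ths`_0 - c)) *
         \sum_(a <- th) (\prod_(c <- take i th') (a - c)) * m a.
Proof.
move=> uth full stds fulls ths_gt0.
have [v v0 nzv] : exists2 v, v \in leigenspace As ths`_0 & v != 0.
  by apply: (@eigenvector_ex _ _ _ ths); [case: stds | rewrite mem_nth].
have thsE : ths = ths`_0 :: behead ths by case: (ths) ths_gt0.
set N := factors As (behead ths).
have Nv : N v != 0.
  rewrite /N (factors_eigen _ v0) scaler_eq0 (negPf nzv) orbF prod_sub_neq0 //.
  by case: stds; rewrite {1}thsE /= => /andP[].
have [j Nvj] : exists j, coord (vbasis fullv) j (N v) != 0.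
  apply/existsP; apply: contraNT Nv; rewrite negb_exists => /forallP Nv0.
  rewrite (coord_vbasis (memvf (N v))) big1 // => j _.
  by have := Nv0 j; rewrite negbK => /eqP->; rewrite scale0r.
have [m mP] : exists m : F -> F, forall s,
    coord (vbasis fullv) j (N (factors A s v))
      = \sum_(a <- th) (\prod_(c <- s) (a - c)) * m a.
  by apply: spectral_weights; rewrite ?full ?memvf.
exists (fun a => m a / coord (vbasis fullv) j (N v)) => th' z i [szz zP] sz lti.
have := congr1 (fun x => coord (vbasis fullv) j (N x)) (zP i _ v v0).
rewrite /= sz => /(_ lti).
rewrite split_operatorE ?sz // factors_behead_eigen // (linearZ_LR N).
rewrite !(linearZ_LR (coord _ j)) /= mP => zi.
apply: (mulIf Nvj); apply: etrans (esym zi) _; rewrite -mulrA.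
apply: (congr1 ( *%R _)).
by rewrite big_distrl; apply: eq_bigr => a _ /=; rewrite -!mulrA mulVf ?mulr1.
Qed.

Lemma seq_choice n (P : nat -> F -> Prop) :
  (forall i, (i < n)%N -> exists c, P i c) ->
  exists z : seq F, size z = n /\ forall i, (i < n)%N -> P i z`_i.
Proof.
move=> Pn; have [f fP] := fin_all_exists (fun i : 'I_n => Pn i (ltn_ord i)).
exists [seq f i | i <- enum 'I_n]; rewrite size_map size_enum_ord; split=> // i lti.
rewrite (nth_map (Ordinal lti)) ?size_enum_ord //.
have -> : nth (Ordinal lti) (enum 'I_n) i = Ordinal lti.
  exact: (nth_ord_enum _ (Ordinal lti)).
exact: fP (Ordinal lti).
Qed.

(** Rewriting the roots in [s] one at a time into the next entry of [th]
    expresses the product as a combination of the prefix products of [th], on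
    which [z] gives the action. *)
Lemma split_compress_scalar A As th ths z s k :
    size th = size ths -> split_sequence A As th ths z ->
    (size s + k < size ths)%N ->
  exists c, forall v, v \in leigenspace As ths`_0 ->
    factors As (take (size s + k) (behead ths))
        (factors A s (factors A (take k th) v))
      = c *: v.
Proof.
move=> sz [_ zP]; elim: s k => [|a s IH] k /= ltk.
  rewrite add0n in ltk *; exists z`_k => v v0; rewrite factors_nil.
  by rewrite -split_operatorE ?sz // zP ?sz.
have [|c1 c1P] := IH k.+1; first by rewrite addnS.
have [|c2 c2P] := IH k; first exact: ltn_trans ltk.
pose b := (behead ths)`_(size s + k).
exists (c1 + (th`_k - a) * (c2 * (ths`_0 - b))) => v v0.
have ltkt : (k < size th)%N by rewrite sz (leq_ltn_trans _ ltk) // leqW ?leq_addl.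
set w := factors A (take k th) v.
have Aw : A w = factors A (take k.+1 th) v + th`_k *: w.
  by rewrite (take_nth 0) // factors_rcons factors_cons subrK.
have -> : factors A (a :: s) w = factors A s (factors A (take k.+1 th) v)
     + (th`_k - a) *: factors A s w.
  rewrite factors_cons factors_comm Aw linearD (linearZ_LR (factors A s)).
  by rewrite scalerBl addrA.
rewrite linearD (linearZ_LR (factors As _)) scalerDl /=; congr (_ + _).
  by rewrite addSnnS c1P.
have ltb : (size s + k < size (behead ths))%N.
  by rewrite size_behead -ltnS (ltn_predK ltk).
rewrite [take _ _](_ : _ = rcons (take (size s + k) (behead ths)) b); last first.
  by rewrite addSn (take_nth 0 ltb).
rewrite factors_rcons factors_cons c2P // (linearZ_LR As) /=.
move/leigenspaceP: v0 => ->. rewrite !scalerA -scalerBl scalerA; congr (_ *: _).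
by rewrite (mulrBr c2) (mulrC b).
Qed.

Lemma split_sequence_reorder A As th th' ths z :
    size th = size ths -> size th' = size th ->
  split_sequence A As th ths z -> exists z', split_sequence A As th' ths z'.
Proof.
move=> sz sz' zP.
have [z' [szz' z'P]] : exists z' : seq F, size z' = size th' /\
    forall i, (i < size th')%N -> forall v, v \in leigenspace As ths`_0 ->
      split_operator A As th' ths i v = z'`_i *: v.
  apply: (@seq_choice _ (fun i c => forall v, v \in leigenspace As ths`_0 ->
      split_operator A As th' ths i v = c *: v)) => i lti.
  have szi : size (take i th') = i by rewrite size_take lti.
  have [|c cP] := @split_compress_scalar _ _ _ _ _ (take i th') 0 sz zP.
    by rewrite addn0 szi -sz -sz'.
  exists c => v v0; rewrite split_operatorE -?sz -?sz' //.
  by have := cP v v0; rewrite addn0 szi take0 factors_nil.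
by exists z'.
Qed.

End Weights.


(** * Standard orderings are unique up to reversal *)

Section StandardOrderings.

Variables (F : fieldType) (V : vectType F).
Implicit Types (A As : 'End(V)) (s t th ths z : seq F).

(** If the eigenvalues at consecutive places [i] and [i.+1] of [th'] were not
    neighbours in [th], then [As] could not leave the sum of the first [i.+1]
    eigenspaces for [th'], which would be a proper invariant subspace. *)
Lemma standard_neighbours A As th th' i k l :
    irreducible_pair A As ->
    standard_ordering A As th -> standard_ordering A As th' ->
    (i.+1 < size th')%N -> (k < size th)%N -> (l < size th)%N ->
    th'`_i = th`_k -> th'`_i.+1 = th`_l ->
  (l == k.+1) || (k == l.+1).
Proof.
move=> irr std std' lti ltk ltl thk thl.
have [uth _ _] := std; have [uth' th'P _] := std'.
have lti' := ltnW lti.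
apply: contraT; rewrite negb_or => /andP[lk1 kl1].
have lk : l != k.
  apply/eqP => lk; suff : (i == i.+1) by lia.
  by rewrite -(nth_uniq 0 lti' lti uth') thk thl lk.
pose N := [seq th`_j | j <- iota 0 (size th) & ((j <= k.+1) && (k <= j.+1))%N].
have e_N : th`_l \notin N.
  apply/negP => /mapP[j]; rewrite mem_filter mem_iota add0n => /andP[jk /= ltj].
  by move/eqP; rewrite nth_uniq //; lia.
pose W := eigsum A (take i.+1 th').
have notW u : u \in leigenspace A th`_l -> u \in W -> u = 0.
  apply: eigenvector_notin; rewrite -thl; apply/negP => /mem_takeP[j [ji js]].
  by move/eqP; rewrite nth_uniq //; lia.
have AW : (A @: W <= W)%VS.
  by apply/subvP => _ /memv_imgP[x xW ->]; apply: eigsum_stable.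
have AsW : (As @: W <= W)%VS.
  apply/subvP => _ /memv_imgP[x xW ->].
  move: xW; rewrite {1}/W (take_nth 0) // eigsum_rcons.
  case/memv_addP => x' x'i [y yi ->] {x}; rewrite linearD rpredD //.
    exact: step_take std' x'i.
  have : As y \in eigsum A (take i.+2 th').
    apply: (step_take std'); apply: subvP yi; apply: sub_eigsum.
    by apply/mem_takeP; exists i.
  rewrite (take_nth 0 lti) eigsum_rcons -/W => /memv_addP[w wW [u ul Asy]].
  have AsyN : As y \in eigsum A N.
    rewrite thk in yi; apply: standard_step std ltk _ yi => j js jk kj.
    by apply: map_f; rewrite mem_filter mem_iota add0n jk kj js.
  have := eigsum_factors0 (fun c cN => cN) AsyN.
  rewrite thl in ul; rewrite Asy linearD /= (factors_eigen N ul) addrC => /eqP.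
  rewrite addr_eq0 => /eqP Nu.
  have p0 := prod_sub_neq0 e_N.
  rewrite Asy rpredD // -[u]scale1r -(mulVf p0) -scalerA rpredZ // Nu rpredN.
  by apply: factors_stable wW => z; apply: eigsum_stable.
have [W0|Wfull] := irr W AW AsW.
  have [u ui u0] := eigenvector_ex th'P (mem_nth 0 lti').
  case/eqP: u0; apply/eqP; rewrite -memv0 -W0; apply: subvP ui.
  by apply: sub_eigsum; apply/mem_takeP; exists i.
have [u ui u0] := eigenvector_ex th'P (mem_nth 0 lti).
by case/eqP: u0; apply: notW; rewrite -?thl ?Wfull ?memvf.
Qed.

(** An injective walk with unit steps cannot turn back. *)
Lemma unit_step_inj (p : nat -> nat) d :
    (forall i, (i <= d)%N -> (p i <= d)%N) ->
    (forall i, (i < d)%N -> (p i.+1 == (p i).+1) || (p i == (p i.+1).+1)) ->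
    (forall i j, (i <= d)%N -> (j <= d)%N -> p i = p j -> i = j) ->
  (forall i, (i <= d)%N -> p i = i) \/ (forall i, (i <= d)%N -> p i = (d - i)%N).
Proof.
move=> pd p_step p_inj.
have [d0|d_gt0] := posnP d.
  by left=> i le_id; have := pd i le_id; lia.
have back i : (i.+1 < d)%N -> p i.+2 <> p i.
  by move=> lti /p_inj; lia.
have [up|down] := orP (p_step 0%N d_gt0).
  have pE i : (i < d)%N -> (p i = p 0 + i /\ p i.+1 = p 0 + i.+1)%N.
    elim: i => [|i IH] lti; first by lia.
    by have := back i lti; have := p_step _ lti; have := IH (ltnW lti); lia.
  have {}pE i : (i <= d)%N -> p i = (p 0 + i)%N.
    by case: i => [|i]; [rewrite addn0 | case/pE].
  left=> i le_id; have := pd d (leqnn d).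
  by have := pE d (leqnn d); have := pE i le_id; lia.
have pE i : (i < d)%N -> (p i + i = p 0 /\ p i.+1 + i.+1 = p 0)%N.
  elim: i => [|i IH] lti; first by lia.
  by have := back i lti; have := p_step _ lti; have := IH (ltnW lti); lia.
have {}pE i : (i <= d)%N -> (p i + i = p 0)%N.
  by case: i => [|i]; [rewrite addn0 | case/pE].
right=> i le_id; have := pd 0%N (leq0n d).
by have := pE d (leqnn d); have := pE i le_id; lia.
Qed.

(** The walk is the position in [th] of the successive entries of [th']. *)
Lemma standard_ordering_unique A As th th' :
    irreducible_pair A As ->
    standard_ordering A As th -> standard_ordering A As th' ->
  th' = th \/ th' = rev th.
Proof.
move=> irr std std'.
have [uth thP _] := std; have [uth' th'P _] := std'.
have eq_th : th' =i th by move=> a; rewrite thP th'P.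
have sz : size th' = size th.
  by apply/eqP; rewrite eq_sym -(uniq_size_uniq uth' eq_th).
have [th0|th_gt0] := posnP (size th).
  by left; rewrite (size0nil th0); apply: size0nil; rewrite sz.
pose p i := index th'`_i th.
have pK i : (i < size th)%N -> (p i < size th)%N /\ th`_(p i) = th'`_i.
  move=> lti; have th_i : th'`_i \in th by rewrite -eq_th mem_nth ?sz.
  by rewrite /p nth_index // index_mem.
have dE i : (i <= (size th).-1)%N = (i < size th)%N by rewrite -ltnS prednK.
have [|||pE|pE] := @unit_step_inj p (size th).-1.
- by move=> i; rewrite !dE => /pK[].
- move=> i; rewrite ltn_predRL => lti.
  have [pi ei] := pK i (ltnW lti); have [pj ej] := pK _ lti.
  by apply: standard_neighbours irr std std' _ pi pj (esym ei) (esym ej); rewrite sz.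
- move=> i j; rewrite !dE => lti ltj eq_p.
  have [_ ei] := pK i lti; have [_ ej] := pK j ltj.
  by move: ei; rewrite eq_p ej => /eqP; rewrite nth_uniq ?sz // => /eqP.
- left; apply: (@eq_from_nth _ 0) => // i; rewrite sz => lti.
  by have [_ <-] := pK i lti; rewrite pE ?dE.
right; apply: (@eq_from_nth _ 0); rewrite ?size_rev // => i; rewrite sz => lti.
have [_ <-] := pK i lti; rewrite nth_rev // pE ?dE //.
by rewrite -subn1 -subnDA.
Qed.

Lemma standard_ordering_rev A As th :
  standard_ordering A As th -> standard_ordering A As (rev th).
Proof.
move=> [uth thP tri]; split; first by rewrite rev_uniq.
  by move=> a; rewrite mem_rev.
move=> i; rewrite size_rev => lti; rewrite nth_rev //.
have lti' : (size th - i.+1 < size th)%N by lia.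
apply: subv_trans (tri _ lti') _; apply/subv_sumP => j /andP[ji ij].
have ltj := ltn_ord j.
have ltj' : (size th - j.+1 < size th)%N by lia.
apply: (sumv_sup (Ordinal ltj')) => /=; first by lia.
rewrite nth_rev //.
by have -> : (size th - (size th - j.+1).+1 = j)%N by lia.
Qed.

End StandardOrderings.


(** * Drinfel'd polynomials for eigenvalues in arithmetic progression *)

Section DrinfeldPolynomials.

Variable F : fieldType.
Hypothesis charF0 : [pchar F] =i pred0.
Implicit Types (b c m : F) (d i j : nat) (z : seq F).

(** This is the type II form with vanishing constant and quadratic
    coefficients. *)
Definition arith_seq d b : seq F :=
  mkseq (fun i => b * (i%:R - d%:R / 2%:R)) d.+1.

Lemma natr_eq0 n : (n%:R == 0 :> F) = (n == 0)%N.
Proof. by move/pcharf0P: charF0 => ->. Qed.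

Lemma natr_neq0 n : (0 < n)%N -> n%:R != 0 :> F.
Proof. by rewrite natr_eq0 -lt0n. Qed.

Lemma nth_arith_seq d b i :
  (i <= d)%N -> (arith_seq d b)`_i = b * (i%:R - d%:R / 2%:R).
Proof. by move=> le_id; rewrite nth_mkseq. Qed.

Lemma half_double d : d%:R = d%:R / 2%:R *+ 2 :> F.
Proof. by rewrite -[RHS]mulr_natr divfK // natr_neq0. Qed.

Lemma krawtchouk_seqE d : krawtchouk_seq F d = arith_seq d (- 2%:R).
Proof.
apply: eq_mkseq => i; rewrite natrM mulrBr !mulNr opprK mulrCA divff ?natr_neq0 //.
by rewrite mulr1 addrC.
Qed.

Lemma krawtchouk_seq_dualE d : krawtchouk_seq_dual F d = arith_seq d 2%:R.
Proof.
apply: eq_mkseq => i; rewrite natrM mulrBr [2%:R * (_ / _)]mulrCA divff ?natr_neq0 //.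
by rewrite mulr1.
Qed.

Lemma rev_arith_seq d b : rev (arith_seq d b) = arith_seq d (- b).
Proof.
apply: (@eq_from_nth _ 0); first by rewrite size_rev !size_mkseq.
move=> i; rewrite size_rev size_mkseq => lti.
rewrite nth_rev size_mkseq // !nth_mkseq ?subSS ?ltnS ?leq_subr //.
rewrite natrB -1?ltnS // mulNr -mulrN; congr (_ * _).
by rewrite opprB {1}(half_double d); ring.
Qed.

Lemma prod_natr_fact d i : (i <= d)%N ->
  \prod_(i.+1 <= j < d.+1) j%:R = d`!%:R / i`!%:R :> F.
Proof.
move=> le_id; apply: (canRL (mulfK (natr_neq0 (fact_gt0 i)))).
by rewrite mulrC !fact_prod !natr_prod -big_cat_nat.
Qed.

Lemma prod_p_hat d b b' i : (i <= d)%N ->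
  \prod_(i.+1 <= j < d.+1) p_hat d b 0 b' 0 j
    = (d`!%:R / i`!%:R) ^+ 2 *: ((b * b' / 2%:R)%:P - 'X) ^+ (d - i).
Proof.
move=> le_id; set t := _ - 'X.
rewrite (eq_bigr (fun j => j%:R ^+ 2 *: t)) => [|j _]; last first.
  by rewrite /p_hat !(mulr0, mul0r, addr0).
by rewrite scaler_prod prodrXl prod_natr_fact // prodr_const_nat subSS.
Qed.

(** The sum over [i] may run up to [d]: the binomial coefficient cuts it off at
    [g]. *)
Lemma sum_binomial_scale (R : comNzRingType) (t q : R) d g : (g <= d)%N ->
  \sum_(i < d.+1) (t ^+ (d - i) * q ^+ i) *+ 'C(g, i)
    = t ^+ (d - g) * (t + q) ^+ g.
Proof.
move=> le_gd; rewrite exprDn big_distrr /=.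
rewrite (big_ord_widen d.+1 (fun i => t ^+ (d - g) *
   (t ^+ (g - i) * q ^+ i *+ 'C(g, i)))) ?ltnS // [in RHS]big_mkcond /=.
apply: eq_bigr => i _; rewrite ltnS; case: leqP => [le_ig|/bin_small->//].
by rewrite mulrnAr mulrA -exprD addnBA // subnK.
Qed.

Lemma prod_sub_nat (g i : nat) :
  \prod_(k < i) (g%:R - k%:R) = (g ^_ i)%:R :> F.
Proof.
have [le_ig|lt_gi] := leqP i g.
  rewrite ffact_prod natr_prod; apply: eq_bigr => k _.
  by rewrite natrB // ltnW // (leq_trans (ltn_ord k)).
rewrite ffact_small // (bigD1 (Ordinal lt_gi)) //=.
by rewrite subrr mul0r.
Qed.

(** Here [m] is the weight of [split_weights] and [g y] is the place, in the
    ordering used for [z], of the [y]-th eigenvalue. The powers of [e] and [b']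
    combine with the binomial expansion of the second factor, as
    [e * b' / 2 - e * b' = - (e * b' / 2)]. The right-hand side is unchanged when
    [e] becomes [- e] and [g y] becomes [d - g y]: this is what makes the
    polynomial independent of the ordering. *)
Lemma P_hat_of_weights d z e b' (g : nat -> nat) (m : nat -> F) :
    (forall y, (y <= d)%N -> (g y <= d)%N) ->
    (forall i, (i <= d)%N -> z`_i = (\prod_(j < i) (- b' * j.+1%:R)) *
       \sum_(y < d.+1) (\prod_(k < i) (e * ((g y)%:R - k%:R))) * m y) ->
  P_hat d z e 0 b' 0 = \sum_(y < d.+1) (d`!%:R ^+ 2 * m y) *:
    (((e * b' / 2%:R)%:P - 'X) ^+ (d - g y) *
     ((- (e * b' / 2%:R))%:P - 'X) ^+ g y).
Proof.
move=> gd zE; set t := (e * b' / 2%:R)%:P - 'X; pose q := - (e * b').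
have -> : (- (e * b' / 2%:R))%:P - 'X = t + q%:P.
  rewrite /t addrAC -polyCD; congr (_%:P - 'X); rewrite /q.
  by field; rewrite natr_neq0.
under [RHS]eq_bigr => y _ do
  rewrite -sum_binomial_scale ?gd -1?ltnS // scaler_sumr.
rewrite exchange_big; apply: eq_bigr => i _ /=.
have le_id : (i <= d)%N by rewrite -ltnS.
rewrite prod_p_hat // -/t scalerA zE // mulrAC -mulrA big_distrr big_distrr /=.
rewrite scaler_suml; apply: eq_bigr => y _.
rewrite -polyC_exp (mulrC (t ^+ _)) mul_polyC scalerMnl scalerA; congr (_ *: _).
have prodE : \prod_(j < i) (- b' * j.+1%:R) = (- b') ^+ i * i`!%:R :> F.
  rewrite big_split /= prodr_const card_ord; congr (_ * _).
  by rewrite fact_prod natr_prod big_add1 big_mkord.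
have prodE' : \prod_(k < i) (e * ((g y)%:R - k%:R))
    = e ^+ i * ('C(g y, i)%:R * i`!%:R).
  by rewrite big_split /= prodr_const card_ord prod_sub_nat -bin_ffact natrM.
rewrite prodE prodE'.
rewrite -[q ^+ i *+ _]mulr_natr (_ : q = - b' * e) ?exprMn; last by rewrite /q; ring.
by field; exact: natr_neq0 (fact_gt0 i).
Qed.

Lemma type_II_form_arith d a b c be : type_II_form d a b c (arith_seq d be) ->
  (0 < d)%N -> b = be /\ c * (d - 1)%:R = 0.
Proof.
move=> typ d_gt0; have := typ 0%N (leq0n d); have := typ d (leqnn d).
have := typ 1%N d_gt0; rewrite !nth_arith_seq // subnn !muln0 mul0n mulr0 !addr0.
rewrite mul1n sub0r => E1 Ed E0.
have d0 := natr_neq0 d_gt0.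
have ddE := half_double d.
have bE : b = be.
  apply: (mulIf d0).
  have : be * (d%:R - d%:R / 2%:R) - be * - (d%:R / 2%:R)
       = b * (d%:R - d%:R / 2%:R) - b * - (d%:R / 2%:R).
    by rewrite Ed E0; ring.
  by rewrite -!mulrBr opprK subrK => ->.
split=> //; rewrite bE in E1 E0.
have a0 : a = 0 by apply: (addIr (be * - (d%:R / 2%:R))); rewrite -E0 add0r.
move: E1; rewrite a0 add0r => /eqP.
by rewrite eq_sym -subr_eq0 addrAC subrr add0r => /eqP.
Qed.

(** The quadratic coefficient [c] is undetermined when [d = 1], but then it
    comes with the factor [d - j = 0]. *)
Lemma P_hat_type_II d z b c b' c' (be be' a a' : F) :
    type_II_form d a b c (arith_seq d be) ->
    type_II_form d a' b' c' (arith_seq d be') ->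
  P_hat d z b c b' c' = P_hat d z be 0 be' 0.
Proof.
move=> typ typ'; apply: eq_bigr => i _; congr (_ *: _).
rewrite !big_nat; apply: eq_bigr => j /andP[lt_ij lt_jd].
have d_gt0 : (0 < d)%N.
  by rewrite -ltnS (leq_ltn_trans _ lt_jd) // (leq_trans _ lt_ij).
have [-> c0] := type_II_form_arith typ d_gt0.
have [-> c0'] := type_II_form_arith typ' d_gt0.
have cj0 (x : F) : x * (d - 1)%:R = 0 -> x * (d - j)%:R = 0.
  move/eqP; rewrite mulf_eq0 => /orP[/eqP->|]; first by rewrite mul0r.
  rewrite natr_eq0 => /eqP d1; have -> : (d - j)%N = 0%N by lia.
  by rewrite mulr0.
rewrite /p_hat; congr (_ *: (_%:P - 'X)); set x := (d - j)%:R.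
have cx : c * x = 0 by apply: cj0.
have cx' : c' * x = 0 by apply: cj0.
transitivity (be * be' / 2%:R + be * (c' * x) + be' * (c * x) + (c * x) * (c' * x)).
  by ring.
by rewrite cx cx'; ring.
Qed.

(** For these orderings the product [b * b' / 2] is [-2], whence the variable
    [lambda + 2]. *)
Lemma P_hat_krawtchouk d z :
  (P_hat d z (- 2%:R) 0 2%:R 0)%:F = 
    (-1) ^+ d * d`!%:R ^+ 2 * ('X + 2%:R%:P)%:F ^+ d *
    (map_poly (fun x : F => x%:P%:F) (krawtchouk_Drinfeld d z)).[
       4%:R * ('X + 2%:R%:P)%:F^-1].
Proof.
have -> : map_poly (fun x : F => x%:P%:F) (krawtchouk_Drinfeld d z)
   = map_poly (@FracField.tofrac {poly F} \o polyC) (krawtchouk_Drinfeld d z).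
  by [].
rewrite /krawtchouk_Drinfeld /P_hat !raddf_sum horner_sum big_distrr /=.
apply: eq_bigr => i _; have le_id : (i <= d)%N by rewrite -ltnS.
rewrite map_polyZ map_polyXn hornerZ hornerXn /=.
rewrite prod_p_hat //.
set x := 'X + _; have -> : (- 2%:R * 2%:R / 2%:R)%:P - 'X = - x.
  by rewrite mulfK ?natr_neq0 // polyCN -opprD addrC.
have x0 : x%:F != 0.
  by rewrite tofrac_eq0 /x -[_%:P]opprK -polyCN polyXsubC_eq0.
pose phi := (@FracField.tofrac {poly F} \o polyC)
  : {rmorphism F -> {fraction {poly F}}}.
set l := _ ^+ 2; set k := _ / (_ * _).
have kE : z`_i * l * (-1) ^+ (d - i) = (-1) ^+ d * d`!%:R ^+ 2 * (k * 4%:R ^+ i).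
  have -> : (-1) ^+ d = (-1) ^+ (d - i) * (-1) ^+ i :> F by rewrite -exprD subnK.
  rewrite /k /l; set u := (-1) ^+ i.
  have u2 : u * u = 1 by rewrite -expr2 sqrr_sign.
  have f0 := natr_neq0 (fact_gt0 i).
  have q0 : 4%:R ^+ i != 0 :> F by rewrite expf_neq0 ?natr_neq0.
  transitivity (z`_i * (d`!%:R / i`!%:R) ^+ 2 * (-1) ^+ (d - i) * (u * u)).
    by rewrite u2 mulr1.
  by field; rewrite f0 q0.
clearbody k l.
have phikE : phi (z`_i * l) * (-1) ^+ (d - i)
    = (-1) ^+ d * d`!%:R ^+ 2 * (phi k * 4%:R ^+ i).
  have := congr1 phi kE; rewrite (rmorphM phi (z`_i * l)) !rmorphM.
  by rewrite !rmorphXn !rmorphN1 !rmorph_nat => ->; rewrite !expr2.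
have -> : x%:F ^+ d = x%:F ^+ (d - i) * x%:F ^+ i by rewrite -exprD subnK.
have -> : (z`_i *: (l *: (- x) ^+ (d - i)))%:F
    = phi (z`_i * l) * (-1) ^+ (d - i) * x%:F ^+ (d - i).
  rewrite scalerA -mul_polyC (exprNn x) (rmorphM (@FracField.tofrac _)) -mulrA.
  congr (_ * _).
  by rewrite (rmorphM (@FracField.tofrac _)) !rmorphXn rmorphN1.
rewrite phikE -[_%:P%:F]/(phi k) exprMn exprVn.
have cancel_w (K : fieldType) (r q c u w : K) : w != 0 ->
    r * (c * q) * u = r * (u * w) * (c * (q / w)).
  by move=> w0; field.
exact: cancel_w (expf_neq0 i x0).
Qed.

End DrinfeldPolynomials.

(** * Independence of the choice of orderings *)

Section Krawtchouk.

Variables (F : fieldType) (V : vectType F).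
Hypothesis charF0 : [pchar F] =i pred0.
Implicit Types (A As : 'End(V)) (b : F) (z : seq F) (d : nat).

Lemma prod_take (f : F -> F) s i : (i <= size s)%N ->
  \prod_(c <- take i s) f c = \prod_(j < i) f s`_j.
Proof.
move=> le_is; rewrite (big_nth 0) size_takel // big_mkord.
by apply: eq_bigr => j _; rewrite nth_take.
Qed.

Lemma arith_prod_first d b i : (i <= d)%N ->
  \prod_(c <- take i (behead (arith_seq d b))) ((arith_seq d b)`_0 - c)
    = \prod_(j < i) (- b * j.+1%:R).
Proof.
move=> le_id; rewrite prod_take ?size_behead ?size_mkseq //.
apply: eq_bigr => j _; rewrite nth_behead !nth_arith_seq //; last first.
  exact: leq_trans (ltn_ord j) le_id.
by ring.
Qed.

Lemma arith_prod d b y i : (y <= d)%N -> (i <= d)%N ->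
  \prod_(c <- take i (arith_seq d b)) ((arith_seq d b)`_y - c)
    = \prod_(k < i) (b * (y%:R - k%:R)).
Proof.
move=> le_yd le_id; rewrite prod_take ?size_mkseq ?leqW //.
apply: eq_bigr => k _; rewrite !nth_arith_seq //; first by ring.
exact: leq_trans (ltnW (ltn_ord k)) le_id.
Qed.

Lemma arith_prod_rev d b y i : (y <= d)%N -> (i <= d)%N ->
  \prod_(c <- take i (arith_seq d (- b))) ((arith_seq d b)`_y - c)
    = \prod_(k < i) (- b * ((d - y)%:R - k%:R)).
Proof.
move=> le_yd le_id; rewrite -(@arith_prod d (- b) (d - y) i) ?leq_subr //.
apply: eq_bigr => c _; congr (_ - _); rewrite !nth_arith_seq ?leq_subr // natrB //.
by rewrite {2}(half_double charF0 d); ring.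
Qed.

(** Both split sequences are moments of the same weight, which
    [P_hat_of_weights] turns into the same polynomial. *)
Lemma P_hat_reversal A As d b b' z z' :
    standard_ordering A As (arith_seq d b) ->
    standard_ordering As A (arith_seq d b') ->
    eigsum A (arith_seq d b) = fullv -> eigsum As (arith_seq d b') = fullv ->
    split_sequence A As (arith_seq d b) (arith_seq d b') z ->
    split_sequence A As (arith_seq d (- b)) (arith_seq d b') z' ->
  P_hat d z b 0 b' 0 = P_hat d z' (- b) 0 b' 0.
Proof.
move=> std stds full fulls zP z'P.
have uth : uniq (arith_seq d b) by case: std.
have [|m mP] := split_weights uth full stds fulls; first by rewrite size_mkseq.
have mE (e : F) i : \sum_(a <- arith_seq d b)
     (\prod_(c <- take i (arith_seq d e)) (a - c)) * m a =
   \sum_(y < d.+1) (\prod_(c <- take i (arith_seq d e)) ((arith_seq d b)`_y - c))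
       * m (arith_seq d b)`_y.
  by rewrite (big_nth 0) size_mkseq big_mkord.
rewrite (@P_hat_of_weights F charF0 d z b b' id (fun y => m (arith_seq d b)`_y)) //.
  rewrite (@P_hat_of_weights F charF0 d z' (- b) b' (fun y => d - y)%N
    (fun y => m (arith_seq d b)`_y)).
  - apply: eq_bigr => y _; congr (_ *: _).
    by rewrite subKn -1?ltnS // !mulNr opprK mulrC.
  - by move=> y _; apply: leq_subr.
  move=> i le_id; rewrite (mP _ z' i z'P) ?size_mkseq // arith_prod_first // mE.
  by congr (_ * _); apply: eq_bigr => y _; rewrite arith_prod_rev // -ltnS.
move=> i le_id; rewrite (mP _ z i zP) ?size_mkseq // arith_prod_first // mE.
by congr (_ * _); apply: eq_bigr => y _; rewrite arith_prod // -ltnS.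
Qed.

Lemma P_hat_swap d z b b' : P_hat d z b 0 b' 0 = P_hat d z b' 0 b 0.
Proof. 
apply: eq_bigr => i _; congr (_ *: _); apply: eq_bigr => j _.
by rewrite /p_hat (mulrC b) !(mulr0, mul0r, addr0).
Qed.

Lemma split_sequence_uniq A As th ths z z' :
    standard_ordering As A ths -> size th = size ths ->
    split_sequence A As th ths z -> split_sequence A As th ths z' ->
  z = z'.
Proof.
move=> stds sz [szz zP] [szz' z'P].
apply: (@eq_from_nth _ 0); rewrite szz ?szz' // => i lti.
have [v v0 nzv] : exists2 v, v \in leigenspace As ths`_0 & v != 0.
  apply: (@eigenvector_ex _ _ _ ths); first by case: stds.
  by rewrite mem_nth // -sz (leq_ltn_trans _ lti).
have := zP i lti v v0; rewrite z'P // => /eqP.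
by rewrite -subr_eq0 -scalerBl scaler_eq0 (negPf nzv) orbF subr_eq0 => /eqP.
Qed.

(** Reversing the eigenvalues of [As] moves the first eigenspace of [As], so the
    weights are not directly comparable. Exchanging [A] and [As] transports both
    split sequences to the first eigenspace of [A], which stays fixed. *)
Lemma P_hat_reversal_dual A As d b b' z z' :
    irreducible_pair A As ->
    standard_ordering A As (arith_seq d b) ->
    standard_ordering As A (arith_seq d b') ->
    standard_ordering As A (arith_seq d (- b')) ->
    eigsum A (arith_seq d b) = fullv -> eigsum As (arith_seq d b') = fullv ->
    eigsum As (arith_seq d (- b')) = fullv ->
    split_sequence A As (arith_seq d b) (arith_seq d b') z ->
    split_sequence A As (arith_seq d b) (arith_seq d (- b')) z' ->
  P_hat d z b 0 b' 0 = P_hat d z' b 0 (- b') 0.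
Proof.
move=> irr std stds stds' full fulls fulls' zP z'P.
rewrite P_hat_swap (P_hat_swap _ z').
by apply: (P_hat_reversal stds std fulls full); apply: split_sequence_swap;
  rewrite ?size_mkseq.
Qed.

End Krawtchouk.

Theorem theorem13p3 (F : closedFieldType) (charF0 : [pchar F] =i pred0)
    (V : vectType F) (V_gt0 : (0 < \dim {:V})%N)
    (A As : 'End(V)) (d : nat)
    (tdA : tridiagonal_pair A As)
    (diamA : has_diameter A As d)
    (krA : krawtchouk_type A As d)
    (Phat : {poly F}) (PhatP : normalized_Drinfeld_II A As d Phat)
    (z : seq F)
    (zP : split_sequence A As (krawtchouk_seq F d) (krawtchouk_seq_dual F d) z) :
  Phat%:F =
    (-1) ^+ d * d`!%:R ^+ 2 * ('X + 2%:R%:P)%:F ^+ d *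
    (map_poly (fun x : F => x%:P%:F) (krawtchouk_Drinfeld d z)).[
       4%:R * ('X + 2%:R%:P)%:F^-1].
Proof.
have [[diag diags] _ _ irr] := tdA.
rewrite -P_hat_krawtchouk //; congr (_ %:F).
case: PhatP => th [ths [z' [a [u [c [a' [u' [c' [[std sz] [stds szs] z'P]]]]]]]]].
move=> [typ typs] ->.
case: krA; rewrite krawtchouk_seqE // krawtchouk_seq_dualE // in zP * => krA krAs.
have irr' : irreducible_pair As A by move=> W ? ?; apply: irr.
have full := eigsum_full diag; have fulls := eigsum_full diags.
have{} full th0 : standard_ordering A As th0 -> eigsum A th0 = fullv.
  by move=> stdth0; apply: full; case: stdth0.
have{} fulls ths0 : standard_ordering As A ths0 -> eigsum As ths0 = fullv.
  by move=> stdths0; apply: fulls; case: stdths0.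
have rev2 : rev (arith_seq d (- 2%:R : F)) = arith_seq d 2%:R.
  by rewrite rev_arith_seq // opprK.
have kr2 : standard_ordering A As (arith_seq d 2%:R).
  by rewrite -rev2; apply: standard_ordering_rev.
have krs2 : standard_ordering As A (arith_seq d 2%:R).
  by rewrite -rev2; apply: standard_ordering_rev.
have szE (b b' : F) : size (arith_seq d b) = size (arith_seq d b').
  by rewrite !size_mkseq.
have [b [thE bE]] : exists b : F, th = arith_seq d b /\ (b = - 2%:R \/ b = 2%:R).
  have [->|->] := standard_ordering_unique irr krA std.
    by exists (- 2%:R); split; [|left].
  by exists 2%:R; rewrite rev2; split; [|right].
have [b' [thsE b'E]] :
    exists b' : F, ths = arith_seq d b' /\ (b' = 2%:R \/ b' = - 2%:R).
  have [->|->] := standard_ordering_unique irr' krAs stds.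
    by exists (- 2%:R); split; [|right].
  by exists 2%:R; rewrite rev2; split; [|left].
subst th ths; rewrite (P_hat_type_II charF0 _ typ typs).
(* [z1] belongs to the ordering of [A] used by [z'] and to the ordering of
   [As] used by [z], so that one reversal at a time remains *)
have [z1 z1P] := split_sequence_reorder (szE _ _) (szE b _) zP.
transitivity (P_hat d z1 b 0 2%:R 0).
  case: b'E stds typs z'P => -> stds' typs z'P.
    by rewrite (split_sequence_uniq stds' (szE _ _) z'P z1P).
  by apply/esym/(P_hat_reversal_dual charF0 irr std krs2 krAs); rewrite ?full ?fulls.
case: bE std z1P {typ z'P} => -> std' z1P.
  by rewrite (split_sequence_uniq krs2 (szE _ _) zP z1P).
apply/esym; have := P_hat_reversal charF0 krA krs2 (full _ krA) (fulls _ krs2) zP.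
by rewrite opprK; apply.
Qed.
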